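(* Let $w_1,\dots,w_n$ be positive integers, let $d=\sum_{i=1}^n w_i$, and assume $w_i\mid d$ for all $i$. Let $1\le k\le n$ with $\gcd(w_1,\dots,w_k)=1$, and let $\beta\in\mathcal{M}=\mathcal{M}(w_1,\dots,w_n)$ satisfy $l(\beta)=1$ and $\beta_{k+1}=\dots=\beta_n=0$. Then the number of tuples $(x_{k+1},\dots,x_n)$ which appear as the last $(n-k)$ entries of an element of $\mathcal{M}$ and do not involve any entry of the form $x_i=\frac{d}{w_i}-1$ (in the $i$-th position, $k+1\le i\le n$) is precisely $$\prod_{i=k+1}^n\left(\frac{d}{w_i}-1\right).$$ If $\beta_i\neq0$ for all $1\le i\le k$, this coincides with the Milnor number of each of the singularities appearing in the singular fibres of the $1$-parameter family of hypersurfaces in $\mathbb{P}_{w_1,\dots,w_n}$ over $\mathbb{A}^1_{\mathbb{C}}$ (with parameter $a$) given by $$F=\left(\sum_{i=1}^{n}x_i^{\frac{d}{w_i}}\right)+a\cdot\prod_{i=1}^{k}x_i^{\beta_i}.$$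
   Context: $\mathcal{M}(w_1,\dots,w_n)$ is the set of exponent tuples $\mathbf{x}=(x_1,\dots,x_n)$, where the $i$-th entry is taken modulo $\frac{d}{w_i}$ (represented by an integer $0\le x_i\le\frac{d}{w_i}-1$), such that the weighted degree $\sum_{i=1}^n x_iw_i$ is an integer multiple of $d$; write $l(\mathbf{x}):=\frac1d\sum_i x_iw_i$ (computed with the representatives $0\le x_i\le\frac{d}{w_i}-1$). $\mathbb{P}_{w_1,\dots,w_n}$ is the weighted projective space $(\mathbb{C}^n\setminus\{0\})/\mathbb{C}^*$, where $\lambda\in\mathbb{C}^*$ acts by $\lambda\cdot(x_1,\dots,x_n)=(\lambda^{w_1}x_1,\dots,\lambda^{w_n}x_n)$. The fibre over $a\in\mathbb{C}$ is $\{F_a=0\}\subset\mathbb{P}_{w_1,\dots,w_n}$. Singularities are understood via the affine cone: a singularity of the fibre over $a$ is a point $p$ of $\mathbb{P}_{w_1,\dots,w_n}$ at which all partial derivatives $\partial F_a/\partial x_i$, $1\le i\le n$, vanish; a fibre is singular if it has at least one singularity. The Milnor number of $p$ is that of the hypersurface germ in $\mathbb{C}^{n-1}$ obtained by setting equal to $1$ a coordinate that does not vanish at $p$ (e.g. $x_1=1$), at a point representing $p$. Empty products equal $1$. *)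

(* Defs.v *)
(* The complex numbers are R[i] for R : realType, and indices
   1, ..., n are shifted to 0, ..., n - 1. *)
From HB Require Import structures.
From mathcomp Require Import all_boot all_order all_algebra.
From mathcomp Require Import classical_sets reals complex.
From mathcomp Require Import mpoly.

Set Implicit Arguments.
Unset Strict Implicit.
Unset Printing Implicit Defensive.

Import Order.TTheory GRing.Theory Num.Theory.
Local Open Scope ring_scope.

Section Exponents.
Variables (n : nat) (w : 'I_n -> nat).

Definition wdeg : nat := (\sum_(i < n) w i)%N.

Definition expo := {dffun forall i : 'I_n, 'I_(wdeg %/ w i)}.

Definition wsum (x : expo) : nat := (\sum_(i < n) x i * w i)%N.

Definition expoM : {set expo} := [set x | (wdeg %| wsum x)%N].

(* The division is exact on expoM. *)
Definition wlen (x : expo) : nat := (wsum x %/ wdeg)%N.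

Definition tail_idx (k : nat) := {i : 'I_n | (k <= i)%N}.

Definition tail_expo (k : nat) :=
  {dffun forall i : tail_idx k, 'I_(wdeg %/ w (val i))}.

Definition tail k (x : expo) : tail_expo k := [ffun i => x (val i)].

Definition clean_tails k : {set tail_expo k} :=
  [set t in [set tail k x | x in expoM] |
    [forall i, (t i != (wdeg %/ w (val i)).-1 :> nat)]].

End Exponents.

Section WeightedProjectiveSpace.
Variables (R : realType) (n : nat) (w : 'I_n -> nat).
Local Open Scope classical_set_scope.

Definition worbit (p : 'I_n -> R[i]) : set ('I_n -> R[i]) :=
  [set q | exists2 l : R[i], l != 0 & forall i, q i = l ^+ w i * p i].

(* A point of the weighted projective space is an orbit in C^n \ {0}. *)
Definition wproj : set (set ('I_n -> R[i])) :=
  [set worbit p | p in [set p | exists i, p i != 0]].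

(* For the weighted homogeneous polynomials F considered here the choice of
   the representative p of the point P is immaterial. *)
Definition wsingular (F : {mpoly R[i][n]}) (P : set ('I_n -> R[i])) : Prop :=
  wproj P /\ exists2 p, P p & forall i, F^`M(i).@[p] = 0.

End WeightedProjectiveSpace.

Section MilnorNumber.
Variables (R : realType) (m : nat).

Definition pseries := 'X_{1..m} -> R[i].

Definition convergent (g : pseries) : Prop :=
  exists M r : R[i], 0 < r /\ forall u, `|g u| * r ^+ mdeg u <= M.

Definition pseries_mul (g h : pseries) : pseries := fun u =>
  \sum_(k : 'X_{1..m < (mdeg u).+1, (mdeg u).+1} | u == (k.1 + k.2)%MM)
    g k.1 * h k.2.

(* The ideal of C{y_1, ..., y_m} generated by the partial derivatives of f. *)
Definition jacobian_ideal (f : {mpoly R[i][m]}) (g : pseries) : Prop :=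
  exists b : 'I_m -> pseries, (forall j, convergent (b j)) /\
    forall u, g u = \sum_(j < m) pseries_mul (b j) (fun v => f^`M(j)@_v) u.

(* dim_C C{y_1, ..., y_m} / (df/dy_1, ..., df/dy_m) = mu: the classes of
   e_1, ..., e_mu form a C-basis of the quotient. *)
Definition germ_milnor (f : {mpoly R[i][m]}) (mu : nat) : Prop :=
  exists e : 'I_mu -> pseries, (forall s, convergent (e s)) /\
    forall g, convergent g ->
      exists! c : 'rV[R[i]]_mu,
        jacobian_ideal f (fun u => g u - \sum_(s < mu) c 0 s * e s u).

End MilnorNumber.

Section Charts.
Variables (R : realType) (n : nat).

(* F with the i0-th coordinate set to 1 and the other n - 1 coordinates
   translated so that the point q becomes the origin. *)
Definition local_eq (F : {mpoly R[i][n]}) (i0 : 'I_n) (q : 'I_n -> R[i])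
    : {mpoly R[i][n.-1]} :=
  F \mPo [tuple if unlift i0 i is Some j then 'X_j + (q i)%:MP else 1 | i < n].

(* No chart i0 and no normalised representative q is privileged; such a pair
   exists for every i0 with nonzero coordinate, by worbit_normalise. *)
Definition milnor_number (F : {mpoly R[i][n]}) (P : set ('I_n -> R[i]))
    (mu : nat) : Prop :=
  forall i0 q, P q -> q i0 = 1 -> germ_milnor (local_eq F i0 q) mu.

Lemma worbit_normalise (w : 'I_n -> nat) (p : 'I_n -> R[i]) (i0 : 'I_n) :
  (0 < w i0)%N -> p i0 != 0 -> exists2 q, worbit w p q & q i0 = 1.
Proof.
move=> w_gt0 p_neq0; pose l := (w i0).-root (p i0)^-1.
have lE : l ^+ w i0 = (p i0)^-1 by rewrite rootCK.
exists (fun i => l ^+ w i * p i); last by rewrite lE mulVf.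
exists l => //; apply: contra_neq (invr_neq0 p_neq0) => l0.
by rewrite -lE l0 expr0n gtn_eqF.
Qed.

End Charts.

Definition monomial_def (R : realType) (n : nat) (w : 'I_n -> nat) (k : nat)
    (beta : expo w) (a : R[i]) : {mpoly R[i][n]} :=
  \sum_(i < n) 'X_i ^+ (wdeg w %/ w i)
    + a *: \prod_(i < n | (i < k)%N) 'X_i ^+ beta i.

(* Main.v *)
(* By Bezout every tail extends to an element of M, which gives the count.  At
   a singular point exactly the first k coordinates are nonzero.  In a chart,
   each of these coordinates minus its value lies in the Jacobian ideal, and
   the derivatives along the other coordinates x_i are multiples of
   x_i ^ (d / w_i - 1); so the ideal is monomial, and the monomials with head
   exponents 0 and tail exponents at most d / w_i - 2 form a basis of the
   quotient. *)
Require Import Defs.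
From HB Require Import structures.
From mathcomp Require Import all_boot all_order all_algebra.
From mathcomp Require Import classical_sets reals complex.
From mathcomp Require Import mpoly.

Set Implicit Arguments.
Unset Strict Implicit.
Unset Printing Implicit Defensive.

Import Order.TTheory GRing.Theory Num.Theory.
Local Open Scope ring_scope.

(** * Convergent power series *)

Section PowerSeries.
Variables (R : realType) (m : nat).
Local Notation K := R[i].
Implicit Types (g h l : pseries R m) (p q : {mpoly K[m]}) (u v : 'X_{1..m}).

Definition pseries_of p : pseries R m := fun u => p@_u.

Definition truncate (N : nat) g : {mpoly K[m]} :=
  \sum_(v : 'X_{1..m < N}) g v *: 'X_[v].

Lemma mcoeff_truncate N g u : (mdeg u < N)%N -> (truncate N g)@_u = g u.
Proof.
move=> u_lt; rewrite /truncate linear_sum /= (bigD1 (BMultinom u_lt)) //=.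
rewrite mcoeffZ mcoeffX eqxx mulr1 big1 ?addr0 // => v v_neq.
by rewrite mcoeffZ mcoeffX -[u]/(val (BMultinom u_lt)) val_eqE (negPf v_neq) mulr0.
Qed.

(** A product coefficient at [u] sees only coefficients of degree at most [mdeg u]. Ring identities
    for series therefore follow from those for polynomials agreeing with them up to degree [N]. *)
Lemma pseries_mul_ext N g h p q u :
  (forall v, (mdeg v < N)%N -> g v = p@_v) ->
  (forall v, (mdeg v < N)%N -> h v = q@_v) ->
  (mdeg u < N)%N -> pseries_mul g h u = (p * q)@_u.
Proof.
move=> gE hE u_lt; rewrite mcoeffM; apply: eq_bigr => k _.
by rewrite gE ?hE //; apply: leq_trans u_lt; apply: bmdeg.
Qed.

Lemma pseries_mulE N g h u : (mdeg u < N)%N ->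
  pseries_mul g h u = (truncate N g * truncate N h)@_u.
Proof.
by move=> u_lt; apply: pseries_mul_ext u_lt => v ?; rewrite mcoeff_truncate.
Qed.

Lemma pseries_mulA g h l :
  pseries_mul g (pseries_mul h l) =1 pseries_mul (pseries_mul g h) l.
Proof.
move=> u; have u_lt := ltnSn (mdeg u).
set N := (mdeg u).+1 in u_lt.
have tE k : forall v, (mdeg v < N)%N -> k v = (truncate N k)@_v.
  by move=> v ?; rewrite mcoeff_truncate.
rewrite (pseries_mul_ext (tE g) (fun v => @pseries_mulE N h l v) u_lt).
rewrite (pseries_mul_ext (fun v => @pseries_mulE N g h v) (tE l) u_lt).
by rewrite mulrA.
Qed.

Lemma eq_pseries_mul g g' h h' :
  g =1 g' -> h =1 h' -> pseries_mul g h =1 pseries_mul g' h'.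
Proof. by move=> gE hE u; apply: eq_bigr => k _; rewrite gE hE. Qed.

Lemma pseries_mul_of p q :
  pseries_mul (pseries_of p) (pseries_of q) =1 pseries_of (p * q).
Proof. by move=> u; rewrite /pseries_of mcoeffM. Qed.

Lemma pseries_1mul g : pseries_mul (pseries_of 1) g =1 g.
Proof.
move=> u; rewrite (@pseries_mul_ext (mdeg u).+1 _ _ 1 (truncate (mdeg u).+1 g)) //.
- by rewrite mul1r mcoeff_truncate.
- by move=> v ?; rewrite mcoeff_truncate.
Qed.

Lemma pseries_mul_sumr (I : Type) (r : seq I) g (h : I -> pseries R m) u :
  pseries_mul g (fun v => \sum_(i <- r) h i v) u =
  \sum_(i <- r) pseries_mul g (h i) u.
Proof. by rewrite exchange_big; apply: eq_bigr => k _; rewrite mulr_sumr. Qed.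

Lemma pseries_mul_suml (I : Type) (r : seq I) (g : I -> pseries R m) h u :
  pseries_mul (fun v => \sum_(i <- r) g i v) h u =
  \sum_(i <- r) pseries_mul (g i) h u.
Proof. by rewrite exchange_big; apply: eq_bigr => k _; rewrite mulr_suml. Qed.

(** A growth rate [B], the inverse of a radius, is easier to combine under sums and products than
    the radius itself. *)
Lemma convergentP g :
  convergent g <->
  exists C B : K, [/\ 0 <= C, 0 <= B & forall u, `|g u| <= C * B ^+ mdeg u].
Proof.
split=> [[M [r [r_gt0 gM]]]|[C [B [C_ge0 B_ge0 gC]]]].
  have M_ge0 : 0 <= M.
    by apply: le_trans (gM 0%MM); rewrite mulr_ge0 ?exprn_ge0 // ltW.
  exists M, r^-1; split; rewrite ?invr_ge0 ?(ltW r_gt0) // => u.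
  by rewrite exprVn ler_pdivlMr ?exprn_gt0.
(* [B] may be 0, so the radius is taken as [(B + 1)^-1]. *)
have B1_gt0 : 0 < B + 1 by rewrite ltr_wpDl.
exists C, (B + 1)^-1; split; first by rewrite invr_gt0.
move=> u; rewrite exprVn ler_pdivrMr ?exprn_gt0 //.
apply: le_trans (gC u) _; rewrite ler_wpM2l // lerXn2r ?nnegrE ?addr_ge0 //.
by rewrite lerDl.
Qed.

Lemma convergent_sum (I : Type) (r : seq I) (g : I -> pseries R m) :
  (forall i, convergent (g i)) -> convergent (fun u => \sum_(i <- r) g i u).
Proof.
move=> g_cvg; elim: r => [|i r /convergentP[C [B [C0 B0 sC]]]].
  by exists 0, 1; split=> // u; rewrite big_nil normr0 mul0r.
have /convergentP[C' [B' [C'0 B'0 giC]]] := g_cvg i.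
apply/convergentP; exists (C' + C), (B' + B); split; rewrite ?addr_ge0 // => u.
rewrite big_cons; apply: le_trans (ler_normD _ _) _; rewrite mulrDl lerD //.
  apply: le_trans (giC u) _; rewrite ler_wpM2l // lerXn2r ?nnegrE ?addr_ge0 //.
  by rewrite lerDl.
apply: le_trans (sC u) _; rewrite ler_wpM2l // lerXn2r ?nnegrE ?addr_ge0 //.
by rewrite lerDr.
Qed.

Lemma convergentZ (c : K) g : convergent g -> convergent (fun u => c * g u).
Proof.
move=> [M [r [r_gt0 gM]]]; exists (`|c| * M), r; split=> // u.
by rewrite normrM -mulrA ler_wpM2l.
Qed.

Lemma pseries_of_convergent p : convergent (pseries_of p).
Proof.
apply/convergentP; exists (\sum_(v <- msupp p) `|p@_v|), 1.
split=> // [|u]; first by rewrite sumr_ge0.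
rewrite expr1n mulr1 /pseries_of; case: (boolP (u \in msupp p)) => up.
  by rewrite (bigD1_seq u) ?msupp_uniq //= lerDl sumr_ge0.
by rewrite (memN_msupp_eq0 up) normr0 sumr_ge0.
Qed.

(** The first summand determines the second and lies below [u] in each coordinate, which leaves at
    most the product of the [u i + 1 <= 2 ^ u i] choices. *)
Lemma card_mnm_split u :
  (#|[set k : 'X_{1..m < (mdeg u).+1, (mdeg u).+1} | u == (k.1 + k.2)%MM]|
   <= 2 ^ mdeg u)%N.
Proof.
pose f (k : 'X_{1..m < (mdeg u).+1, (mdeg u).+1}) :
  {dffun forall i : 'I_m, 'I_(u i).+1} := [ffun i => inord (k.1 i)].
rewrite -(@card_in_imset _ _ f) /=; last first.
  move=> k k'; rewrite !inE => /eqP uk /eqP uk' /ffunP fkk'.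
  have kE i : val k.1 i = val k'.1 i.
    have := congr1 val (fkk' i); rewrite !ffunE /= !inordK // ltnS.
      by move/mnmP/(_ i): uk' ->; rewrite mnmDE leq_addr.
    by move/mnmP/(_ i): uk ->; rewrite mnmDE leq_addr.
  have k1E : val k.1 = val k'.1 by apply/mnmP.
  have k2E : val k.2 = val k'.2 
    by apply: (@addmI _ (val k'.1)); rewrite -{1}k1E -uk -uk'.
  by apply/eqP; rewrite -pair_eqE /pair_eq !bmeqP k1E k2E !eqxx.
apply: leq_trans (max_card _) _; rewrite card_dep_ffun foldrE big_map big_enum /=.
rewrite mdegE expn_sum; apply: leq_prod => i _.
by rewrite card_ord ltn_expl.
Qed.

Lemma convergentM g h :
  convergent g -> convergent h -> convergent (pseries_mul g h).
Proof.
move=> /convergentP[C [B [C0 B0 gC]]] /convergentP[C' [B' [C'0 B'0 hC]]].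
(* The power of [B + B'] dominates both growth rates, and the factor 2 pays for the number of
   splittings of [u]. *)
apply/convergentP; exists (C * C'), (2 * (B + B')).
split; rewrite ?mulr_ge0 ?addr_ge0 // => u.
apply: le_trans (ler_norm_sum _ _ _) _.
have BB0 : 0 <= B + B' by rewrite addr_ge0.
apply: (@le_trans _ _ (\sum_(k : 'X_{1..m < (mdeg u).+1, (mdeg u).+1}
   | u == (k.1 + k.2)%MM) C * C' * (B + B') ^+ mdeg u)).
  apply: ler_sum => k /eqP uk.
  have -> : (B + B') ^+ mdeg u = (B + B') ^+ mdeg k.1 * (B + B') ^+ mdeg k.2.
    by rewrite -exprD -mdegD -uk.
  rewrite normrM mulrACA.
  rewrite ler_pM //.
    apply: le_trans (gC _) _; rewrite ler_wpM2l // lerXn2r ?nnegrE //.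
    by rewrite lerDl.
  apply: le_trans (hC _) _; rewrite ler_wpM2l // lerXn2r ?nnegrE //.
  by rewrite lerDr.
rewrite sumr_const -cardsE exprMn mulrCA -natrX -[leLHS]mulr_natl.
rewrite ler_wpM2r ?mulr_ge0 ?exprn_ge0 //.
by rewrite ler_nat card_mnm_split.
Qed.

Lemma mcoeff_mulX_le (C : K) q u v :
  (forall t, `|q@_t| <= C) -> `|('X_[v] * q)@_u| <= C.
Proof.
move=> qC; case: (boolP (v <= u)%MM) => [/submK uE|vNu].
  by rewrite -uE addmC mulrC mcoeffMX.
rewrite mcoeffM big1 ?normr0 => [|k /eqP uk].
  by apply: le_trans (qC 0%MM).
rewrite mcoeffX; case: eqP => [vk|_]; last by rewrite mul0r.
by case/mnm_lepP: vNu => i; rewrite {}uk mnmDE -vk leq_addr.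
Qed.

(** Each monomial of [p] only shifts the coefficients of [q], so the l1-norm of [p] controls the
    product. *)
Lemma mcoeffM_le (C : K) p q u : (forall t, `|q@_t| <= C) ->
  `|(p * q)@_u| <= (\sum_(v <- msupp p) `|p@_v|) * C.
Proof.
move=> qC; rewrite {1}[p]mpolyE mulr_suml raddf_sum /= mulr_suml.
apply: le_trans (ler_norm_sum _ _ _) _; apply: ler_sum => v _.
by rewrite -scalerAl mcoeffZ normrM ler_wpM2l // mcoeff_mulX_le.
Qed.

Lemma mcoeffXn_le p e u :
  `|(p ^+ e)@_u| <= (\sum_(v <- msupp p) `|p@_v|) ^+ e.
Proof.
elim: e u => [|e IH] u; last by rewrite !exprS; apply: mcoeffM_le.
by rewrite !expr0 mcoeff1 normr_nat lern1 leq_b1.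
Qed.

(** Each of the [e] factors contributes degree at least 1. *)
Lemma mcoeffXn_eq0 p e u :
  p@_0%MM = 0 -> (mdeg u < e)%N -> (p ^+ e)@_u = 0.
Proof.
move=> p0; elim: e u => // e IH u; rewrite ltnS => u_le.
rewrite exprS mcoeffM big1 // => k /eqP uk.
have [->|k1_neq0] := eqVneq (val k.1) 0%MM; first by rewrite p0 mul0r.
rewrite IH ?mulr0 //; apply: leq_trans u_le.
apply: (@leq_trans (mdeg k.1 + mdeg k.2)); last by rewrite -mdegD -uk.
by rewrite -[X in (X < _)%N]add0n ltn_add2r lt0n mdeg_eq0.
Qed.

(** Brings a partial geometric sum into the single-power form that [convergentP] asks for. *)
Lemma geometric_le (S : K) N : 0 <= S -> \sum_(e < N.+1) S ^+ e <= (1 + S) ^+ N.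
Proof.
move=> S0; elim: N => [|N IH]; first by rewrite big_ord1.
rewrite big_ord_recr /= [leRHS]exprSr mulrDr mulr1 lerD // exprSr ler_wpM2r //.
by rewrite lerXn2r ?nnegrE ?addr_ge0 // lerDr.
Qed.

(* The inverse of D = c (1 - E), E(0) = 0, is c^-1 (1 + E + E^2 + ...). *)
Lemma pseries_inverse p : p@_0%MM != 0 ->
  exists2 g, convergent g & pseries_mul g (pseries_of p) =1 pseries_of 1.
Proof.
set c := p@_0%MM => c_neq0; pose E := 1 - c^-1 *: p.
have E0 : E@_0%MM = 0 by rewrite mcoeffB mcoeffZ mcoeff1 eqxx mulVf ?subrr.
pose S := \sum_(v <- msupp E) `|E@_v|.
have S0 : 0 <= S by rewrite sumr_ge0.
(* Powers of [E] beyond [mdeg u] have no coefficient at [u], so this finite sum is the whole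
   geometric series. *)
pose g : pseries R m := fun u => c^-1 * \sum_(e < (mdeg u).+1) (E ^+ e)@_u.
exists g.
  apply: convergentZ; apply/convergentP; exists 1, (1 + S).
  split; rewrite ?addr_ge0 // => u; rewrite mul1r.
  apply: le_trans (ler_norm_sum _ _ _) _; apply: le_trans (geometric_le _ S0).
  by apply: ler_sum => e _; apply: mcoeffXn_le.
move=> u; pose N := (mdeg u).+1.
rewrite (@pseries_mul_ext N _ _ (c^-1 *: \sum_(e < N) E ^+ e) p) //; last first.
  move=> v v_lt; rewrite mcoeffZ raddf_sum /=; congr (_ * _).
  rewrite (big_ord_widen N (fun e => (E ^+ e)@_v)) // big_mkcond /=.
  apply: eq_bigr => e _; case: ltnP => // e_gt.
  by rewrite mcoeffXn_eq0.
have pE : p = c *: (1 - E) by rewrite opprB addrC subrK scalerA mulfV ?scale1r.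
rewrite [in X in _ * X]pE -scalerAl -scalerAr scalerA mulVf // scale1r mulrC.
rewrite -opprB mulNr -subrX1 opprB mcoeffB mcoeffXn_eq0 //.
by rewrite subr0.
Qed.

End PowerSeries.


(** * The Jacobian ideal *)

Section JacobianIdeal.
Variables (R : realType) (m : nat) (f : {mpoly R[i][m]}).
Local Notation K := R[i].
Implicit Types (g h : pseries R m) (p q : {mpoly K[m]}) (u v : 'X_{1..m}).
Local Notation J := (jacobian_ideal f).

Lemma eq_jacobian_ideal g h : g =1 h -> J g -> J h.
Proof. by move=> gh [b [b_cvg gE]]; exists b; split=> // u; rewrite -gh. Qed.

Lemma jacobian_idealM h g : convergent h -> J g -> J (pseries_mul h g).
Proof.
move=> h_cvg [b [b_cvg gE]]; exists (fun j => pseries_mul h (b j)).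
split=> [j|u]; first exact: convergentM.
rewrite (eq_pseries_mul (fun _ => erefl) gE) pseries_mul_sumr.
by apply: eq_bigr => j _; rewrite pseries_mulA.
Qed.

Lemma jacobian_idealD g h : J g -> J h -> J (fun u => g u + h u).
Proof.
move=> [b [b_cvg gE]] [b' [b'_cvg hE]].
(* Writing the sum of two series over [bool] lets the lemmas on finite sums apply. *)
exists (fun j u => \sum_(x : bool) (if x then b else b') j u); split=> [j|u].
  by apply: (@convergent_sum _ _ _ _ (fun x : bool => (if x then b else b') j));
    case.
rewrite gE hE -big_split; apply: eq_bigr => j _.
rewrite (@pseries_mul_suml _ _ _ _ (fun x : bool => (if x then b else b') j)).
by rewrite big_bool.
Qed.

Lemma jacobian_ideal_sum (I : Type) (r : seq I) (g : I -> pseries R m) :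
  (forall i, J (g i)) -> J (fun u => \sum_(i <- r) g i u).
Proof.
move=> Jg; elim: r => [|i r IH]; last first.
  by apply: eq_jacobian_ideal (jacobian_idealD (Jg i) IH) => u; rewrite big_cons.
exists (fun _ => pseries_of 0); split=> [j|u]; first exact: pseries_of_convergent.
rewrite big_nil big1 // => j _.
by rewrite (pseries_mul_of 0 f^`M(j)) mul0r /pseries_of mcoeff0.
Qed.

Lemma jacobian_ideal_deriv j : J (pseries_of f^`M(j)).
Proof.
exists (fun l => pseries_of (l == j)%:R); split=> [l|u].
  exact: pseries_of_convergent.
rewrite (bigD1 j) //= big1 => [|l l_neq].
  by rewrite eqxx addr0 (pseries_mul_of 1 f^`M(j)) mul1r.
by rewrite (negPf l_neq) (pseries_mul_of 0 f^`M(l)) mul0r /pseries_of mcoeff0.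
Qed.

(** A polynomial with nonzero constant term is a unit among convergent series, though usually not
    among polynomials. *)
Lemma jacobian_ideal_cancel p q : p@_0%MM != 0 ->
  J (pseries_of (p * q)) -> J (pseries_of q).
Proof.
move=> /pseries_inverse[g g_cvg gp] /(jacobian_idealM g_cvg).
apply: eq_jacobian_ideal => u.
rewrite (eq_pseries_mul (fun _ => erefl) (fsym (pseries_mul_of p q))).
rewrite pseries_mulA (eq_pseries_mul gp (fun _ => erefl)).
exact: pseries_1mul.
Qed.

Lemma pseries_mulX g v u :
  pseries_mul g (pseries_of 'X_[v]) u = if (v <= u)%MM then g (u - v)%MM else 0.
Proof.
rewrite (@pseries_mul_ext _ _ (mdeg u).+1 _ _ (truncate (mdeg u).+1 g) 'X_[v]) //.
  case: ifP => [/submK uE|vNu].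
    rewrite -{1}uE addmC mcoeffMX mcoeff_truncate //.
    by rewrite ltnS mdegB.
  rewrite mcoeffM big1 // => k /eqP uk.
  rewrite mcoeffX; case: eqP => [vk|_]; last by rewrite mulr0.
  by case/negP: vNu; apply/mnm_lepP=> i; rewrite {}uk mnmDE -vk leq_addl.
by move=> t ?; rewrite mcoeff_truncate.
Qed.

(** * Jacobian ideals generated by powers of the variables *)

Variable thr : 'I_m -> nat.
(** The exponents of the standard monomials: those outside the ideal generated by the
    ['X_l ^+ thr l]. *)
Let box u := forall l, (u l < thr l)%N.

(* Sort the monomials outside the box by the first coordinate reaching its
   threshold. *)
Lemma jacobian_ideal_outside_box g :
  (forall l, J (pseries_of ('X_l ^+ thr l))) ->
  convergent g -> (forall u, box u -> g u = 0) -> J g.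
Proof.
move=> JX /convergentP[C [B [C0 B0 gC]]] g0.
pose top j := (U_(j) *+ thr j)%MM : 'X_{1..m}.
(* [G j] is the quotient by ['X_j ^+ thr j] of the terms of [g] assigned to [j]; the test on
   [v + top j] assigns each term only once. *)
pose G (j : 'I_m) : pseries R m := fun v =>
  if [forall l : 'I_m, (l < j)%N ==> ((v + top j)%MM l < thr l)%N]
  then g (v + top j)%MM else 0.
have G_cvg j : convergent (G j).
  apply/convergentP; exists (C * B ^+ thr j), B.
  split=> // [|v]; first by rewrite mulr_ge0 ?exprn_ge0.
  rewrite /G; case: ifP => _; last by rewrite normr0 !mulr_ge0 ?exprn_ge0.
  apply: le_trans (gC _) _.
  by rewrite mdegD mdegMn mdeg1 mul1n addnC exprD mulrA.
have top_le j u : (top j <= u)%MM = (thr j <= u j)%N.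
  apply/mnm_lepP/idP => [/(_ j)|j_le l].
    by rewrite mulmnE mnm1E eqxx mul1n.
  by rewrite mulmnE mnm1E; case: eqP => [<-|_]; rewrite ?mul1n ?mul0n.
apply: (@eq_jacobian_ideal
  (fun u => \sum_j pseries_mul (G j) (pseries_of ('X_j ^+ thr j)) u)); last first.
  by apply: jacobian_ideal_sum => j; apply: jacobian_idealM.
have termE (j : 'I_m) u : pseries_mul (G j) (pseries_of ('X_j ^+ thr j)) u =
    if (thr j <= u j)%N && [forall l : 'I_m, (l < j)%N ==> (u l < thr l)%N]
    then g u else 0.
  rewrite mpolyXn pseries_mulX top_le; case: (boolP (_ <= _)%N) => //= j_le.
  by rewrite /G submK ?top_le.
move=> u; rewrite (eq_bigr _ (fun j _ => termE j u)).
case: (boolP [exists j, (thr j <= u j)%N]) => [/existsP[j1 j1_le]|].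
  case: (@arg_minnP _ j1 (fun j => (thr j <= u j)%N) (fun j => j : nat) j1_le).
  move=> j j_le j_min; rewrite (bigD1 j) //= j_le.
  have -> : [forall l : 'I_m, (l < j)%N ==> (u l < thr l)%N].
    apply/forallP=> l; apply/implyP=> lj; rewrite ltnNge.
    by apply: contraL lj => /j_min; rewrite leqNgt.
  rewrite big1 ?addr0 // => l l_neq; case: ifP => // /andP[l_le /forallP/(_ j)].
  have jl : (j < l)%N by rewrite ltn_neqAle eq_sym (inj_eq val_inj) l_neq j_min.
  by rewrite jl ltnNge j_le.
rewrite negb_exists => /forallP u_box; rewrite g0 => [|l]; last by rewrite ltnNge.
by rewrite big1 // => j _; rewrite (negPf (u_box j)).
Qed.

(** A divisor of a box monomial is again in the box, so vanishing on the box passes from the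
    generators to the ideal. *)
Lemma jacobian_ideal_box g u :
  (forall j v, box v -> f^`M(j)@_v = 0) -> J g -> box u -> g u = 0.
Proof.
move=> f0 [b [_ gE]] u_box; rewrite gE big1 // => j _; rewrite /pseries_mul big1 //.
move=> k /eqP uk; rewrite f0 ?mulr0 // => l.
by apply: leq_ltn_trans (u_box l); move/mnmP/(_ l): uk ->; rewrite mnmDE leq_addl.
Qed.

(** The box monomials form the basis: the first hypothesis makes them span the quotient, the second
    makes them independent. *)
Lemma germ_milnor_box :
  (forall l, J (pseries_of ('X_l ^+ thr l))) ->
  (forall j u, box u -> f^`M(j)@_u = 0) ->
  germ_milnor f (\prod_l thr l)%N.
Proof.
move=> JX f0; pose T := {dffun forall l, 'I_(thr l)}.
have <- : #|{: T}| = (\prod_l thr l)%N.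
  rewrite card_dep_ffun foldrE big_map big_enum /=.
  by apply: eq_bigr => l _; rewrite card_ord.
pose mon (s : 'I_#|{: T}|) : 'X_{1..m} := [multinom val (enum_val s l) | l < m].
have mon_box s : box (mon s) by move=> l; rewrite mnmE ltn_ord.
have mon_inj : injective mon.
  move=> s s' /mnmP monE; apply/enum_val_inj/ffunP=> l.
  by apply: val_inj; have := monE l; rewrite !mnmE.
have mon_onto u : box u -> exists s, mon s = u.
  move=> u_box; exists (enum_rank ([ffun l => Ordinal (u_box l)] : T)).
  by apply/mnmP=> l; rewrite mnmE enum_rankK ffunE.
have coefE (c : 'rV[K]_#|{: T}|) s :
    \sum_t c 0 t * pseries_of 'X_[mon t] (mon s) = c 0 s.
  rewrite (bigD1 s) //= /pseries_of mcoeffX eqxx mulr1 big1 ?addr0 // => t t_neq.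
  by rewrite mcoeffX (inj_eq mon_inj) (negPf t_neq) mulr0.
exists (fun s => pseries_of 'X_[mon s]); split=> [s|g g_cvg].
  exact: pseries_of_convergent.
exists (\row_s g (mon s)); split=> [|c Jc]; last first.
  apply/rowP=> s; rewrite mxE; have := jacobian_ideal_box f0 Jc (mon_box s).
  by rewrite coefE => /subr0_eq.
apply: jacobian_ideal_outside_box => // [|u /mon_onto[s <-]]; last first.
  by rewrite coefE mxE subrr.
(* The remainder of [g] after removal of its box part is convergent, as a sum of two series indexed
   by [true] and [false]. *)
have := @convergent_sum _ _ _ [:: true; false] (fun x : bool => if x then g else
  fun u => \sum_s (- (\row_s g (mon s)) 0 s) * pseries_of 'X_[mon s] u).
case=> [|M [r [r_gt0 gM]]].
  case=> //; apply: convergent_sum => s; apply: convergentZ.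
  exact: pseries_of_convergent.
exists M, r; split=> // u; apply: le_trans (gM u).
rewrite !big_cons big_nil addr0 -sumrN; under eq_bigr do rewrite -mulNr.
by [].
Qed.

End JacobianIdeal.

(** * Counting tails *)

Section TailCount.
Variables (n : nat) (w : 'I_n -> nat).
Hypothesis w_gt0 : forall i, (0 < w i)%N.
Hypothesis w_dvd : forall i, (w i %| wdeg w)%N.

Lemma wdeg_div_gt0 i : (0 < wdeg w %/ w i)%N.
Proof.
by rewrite divn_gt0 // /wdeg (bigD1 i) //= leq_addr.
Qed.

(** Bezout's identity is iterated over [P]. Support in [P] is what later allows the head of a tuple
    to be corrected without touching its tail. *)
Lemma bezout_big (I : finType) (P : pred I) (c : I -> nat) :
  exists2 z : I -> int, (forall i, ~~ P i -> z i = 0) &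
    \sum_i z i * (c i)%:Z = (\big[gcdn/0%N]_(i | P i) c i)%:Z.
Proof.
elim/big_rec: _ => [|i g Pi [z z0 zE]].
  by exists (fun _ => 0) => //; rewrite big1 // => i _; rewrite mul0r.
have [a [b abE]] := Bezoutz (c i)%:Z g%:Z.
exists (fun l => a * (l == i)%:Z + b * z l) => [l Pl|].
  rewrite z0 // mulr0 addr0; case: eqP Pl => [->|]; last by rewrite mulr0.
  by rewrite Pi.
rewrite (eq_bigr (fun l => a * (l == i)%:Z * (c l)%:Z + b * (z l * (c l)%:Z))).
  rewrite big_split -mulr_sumr zE (bigD1 i) //= eqxx mulr1 big1 ?addr0 //.
  by move=> l /negPf ->; rewrite mulr0 mul0r.
by move=> l _; rewrite mulrDl mulrA.
Qed.

(** Extend the tail by 0, with weighted sum [c], and subtract [c] times a Bezout combination of the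
    head weights: the sum becomes 0. Reducing the entries then keeps it divisible by [wdeg w]. *)
Lemma tail_onto k : \big[gcdn/0%N]_(i < n | (i < k)%N) w i = 1%N ->
  forall t : tail_expo w k, exists2 x, x \in expoM w & tail k x = t.
Proof.
move=> w_gcd t; have [z z0] := bezout_big (fun i : 'I_n => (i < k)%N) w.
rewrite w_gcd => zE.
pose tn i : int := if insub i is Some j then (t j : nat)%:Z else 0.
pose c := \sum_i tn i * (w i)%:Z.
pose y i := tn i - c * z i.
pose m i := (wdeg w %/ w i)%N.
have m_neq0 i : (m i)%:Z != 0 by rewrite eqz_nat -lt0n wdeg_div_gt0.
have yE i : (`|(y i %% m i)%Z|%N)%:Z = (y i %% m i)%Z.
  by rewrite gez0_abs // modz_ge0.
have x_lt i : (`|(y i %% m i)%Z|%N < wdeg w %/ w i)%N.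
  by rewrite -ltz_nat yE ltz_pmod // ltz_nat wdeg_div_gt0.
exists [ffun i => Ordinal (x_lt i)].
  have y_sum : \sum_i y i * (w i)%:Z = 0.
    rewrite (eq_bigr (fun i => tn i * (w i)%:Z - c * (z i * (w i)%:Z))).
      by rewrite sumrB -mulr_sumr zE mulr1 subrr.
    by move=> i _; rewrite mulrBl mulrA.
  rewrite inE; set x := [ffun i => _].
  suff: ((wdeg w)%:Z %| (wsum x)%:Z)%Z by rewrite dvdzE.
  (* Reduction modulo [m i] changes the sum by multiples of [m i * w i = wdeg w]. *)
  rewrite -[X in (_ %| X)%Z]subr0 -y_sum.
  have -> : (wsum x)%:Z = \sum_i (y i %% m i)%Z * (w i)%:Z.
    rewrite -natz /wsum natr_sum; apply: eq_bigr => i _.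
    by rewrite ffunE /= natz PoszM yE.
  rewrite -sumrB; apply: rpred_sum => i _.
  rewrite -mulrBl [X in (_ - X) * _](divz_eq _ (m i)) opprD addrCA subrr addr0.
  by rewrite mulNr -mulrA -PoszM divnK // rpredN dvdz_mull.
(* On the tail [z] vanishes and the entries are already reduced, so [t] is recovered. *)
apply/ffunP=> j; apply: val_inj; rewrite !ffunE /= /y z0; last first.
  by rewrite -leqNgt (valP j).
by rewrite /tn valK mulr0 subr0 modz_nat /= modn_small.
Qed.

(** Since every tail occurs, the entries are chosen independently, each with one forbidden value. *)
Lemma card_clean_tails k : \big[gcdn/0%N]_(i < n | (i < k)%N) w i = 1%N ->
  #|clean_tails w k| = (\prod_(i < n | (k <= i)%N) (wdeg w %/ w i - 1))%N.
Proof.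
move=> w_gcd.
pose top (j : tail_idx n k) : pred 'I_(wdeg w %/ w (val j)) :=
  [pred a : 'I_(wdeg w %/ w (val j)) | a != (wdeg w %/ w (val j)).-1 :> nat].
have -> : #|clean_tails w k| = #|(family top : simpl_pred (tail_expo w k))|.
  apply: eq_card => t; rewrite inE; have [x xM <-] := tail_onto w_gcd t.
  rewrite imset_f //=; apply/forallP/familyP=> xN j; exact: xN.
rewrite card_family foldrE big_map big_enum /=.
rewrite (big_sub [pred i : 'I_n | (k <= i)%N]) /=; apply: eq_bigr => j _.
have last_lt : ((wdeg w %/ w (val j)).-1 < wdeg w %/ w (val j))%N.
  by rewrite prednK ?wdeg_div_gt0.
transitivity #|predC1 (Ordinal last_lt)|; last by rewrite cardC1 card_ord subn1.
by apply: eq_card.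
Qed.

End TailCount.

(** * Germs of the family at its singular points *)

Section IdealCongruence.
Variables (T : comPzRingType) (J : T -> Prop).

(** Serves two ideals of polynomials: those lying in the Jacobian ideal, and those without box
    monomials. *)
Definition is_ideal :=
  [/\ J 0, (forall p q, J p -> J q -> J (p + q)) & forall p q, J q -> J (p * q)].

Hypothesis J_ideal : is_ideal.

Lemma cong_prod (I : finType) (P : pred I) (p q : I -> T) :
  (forall i, P i -> J (p i - q i)) -> J (\prod_(i | P i) p i - \prod_(i | P i) q i).
Proof.
case: J_ideal => J0 JD JM Jpq; elim/big_rec2: _ => [|i x y Pi Jxy].
  by rewrite subrr.
have -> : p i * y - q i * x = p i * (y - x) + x * (p i - q i).
  by rewrite !mulrBr (mulrC x (p i)) (mulrC x (q i)) addrA subrK.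
by apply: JD; apply: JM; last exact: Jpq.
Qed.

Lemma congX p q e : J (p - q) -> J (p ^+ e - q ^+ e).
Proof. by case: J_ideal => _ _ JM Jpq; rewrite subrXX mulrC; apply: JM. Qed.

End IdealCongruence.

(** * Partial derivatives of a Fermat sum plus a monomial *)

Section Derivative.
Variables (K : comNzRingType) (m : nat) (j : 'I_m).
Implicit Types p : {mpoly K[m]}.

Lemma mderivXn p e : (p ^+ e)^`M(j) = (p ^+ e.-1 * p^`M(j)) *+ e.
Proof.
elim: e => [|e IH]; first by rewrite expr0 mderivC mulr0n.
rewrite exprS mderivM IH mulrS mulrC; congr (_ + _).
case: e {IH} => [|e]; first by rewrite !mulr0n mulr0.
by rewrite mulrnAr mulrA -exprS.
Qed.

Lemma mderiv_prod0 (I : finType) (P : pred I) (p : I -> {mpoly K[m]}) :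
  (forall i, P i -> (p i)^`M(j) = 0) -> (\prod_(i | P i) p i)^`M(j) = 0.
Proof.
move=> p0; elim/big_rec: _ => [|i q Pi q0]; first exact: mderivC.
by rewrite mderivM p0 // q0 mul0r mulr0 addr0.
Qed.

Lemma mderivXU i : ('X_i : {mpoly K[m]})^`M(j) = (i == j)%:R.
Proof.
rewrite mderivX mnm1E; case: eqP => [->|_]; last by rewrite scale0r.
by rewrite -{1}[U_(j)%MM]add0m addmK mpolyX0 scale1r.
Qed.

Variables (I : finType) (i1 : I) (t : I -> {mpoly K[m]}) (e b : I -> nat) (a : K).
Variable P : pred I.
Hypothesis dt : forall i, (t i)^`M(j) = (i == i1)%:R.

(** The [t i] stand for homogeneous coordinates or for their expressions in a chart; [i1] is the one
    index whose [t] depends on variable [j]. *)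
Let G := \sum_i t i ^+ e i + a *: \prod_(i | P i) t i ^+ b i.

Lemma mderiv_fermat : (\sum_i t i ^+ e i)^`M(j) = t i1 ^+ (e i1).-1 *+ e i1.
Proof.
rewrite raddf_sum /= (bigD1 i1) //= big1 ?addr0 => [|i /negPf i_neq].
  by rewrite mderivXn dt eqxx mulr1.
by rewrite mderivXn dt i_neq mulr0 mul0rn.
Qed.

Lemma mderiv_outside : ~~ P i1 -> G^`M(j) = t i1 ^+ (e i1).-1 *+ e i1.
Proof.
move=> PN1; rewrite mderivD mderiv_fermat mderivZ mderiv_prod0 ?scaler0 ?addr0 //.
move=> i Pi; rewrite mderivXn dt; case: eqP => [i1E|_].
  by rewrite -i1E Pi in PN1.
by rewrite mulr0 mul0rn.
Qed.

(** Multiplying by [t i1] restores the exponent lowered by differentiation, so both monomials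
    reappear intact. *)
Lemma mderiv_inside : P i1 -> t i1 * G^`M(j) =
  t i1 ^+ e i1 *+ e i1 + (a *: \prod_(i | P i) t i ^+ b i) *+ b i1.
Proof.
have mulX p c : p * (p ^+ c.-1 *+ c) = p ^+ c *+ c.
  by case: c => [|c]; rewrite ?mulr0n ?mulr0 // mulrnAr -exprS.
move=> P1; rewrite mderivD mderiv_fermat mulrDr mulX; congr (_ + _).
rewrite mderivZ -scalerAr scalerMnr; congr (_ *: _).
rewrite (bigD1 i1) //= mderivM mderivXn dt eqxx mulr1 mulrDr mulrA mulX.
rewrite mderiv_prod0 ?mulr0 ?addr0 ?mulrnAl // => i /andP[_ /negPf i_neq].
by rewrite mderivXn dt i_neq mulr0 mul0rn.
Qed.

End Derivative.

(** * The germ at a singular point, in an affine chart *)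

Section FermatGerm.
Variables (R : realType) (n k d : nat) (w e b : 'I_n -> nat).
Local Notation K := R[i].
Variables (a : K) (i0 : 'I_n) (q : 'I_n -> K).
Hypotheses (w_gt0 : forall i, (0 < w i)%N) (ew : forall i, (e i * w i)%N = d).
Hypotheses (b_gt0 : forall i : 'I_n, (i < k)%N -> (0 < b i)%N).
Hypothesis bw : (\sum_(i < n | (i < k)%N) b i * w i)%N = d.
Hypotheses (i0k : (i0 < k)%N) (q_i0 : q i0 = 1).
Hypothesis q_tail : forall i : 'I_n, (k <= i)%N -> q i = 0.
(** The equations [x_i * dF/dx_i = 0] on the cone, including the one at [i0], a direction absent
    from the chart. *)
Hypothesis q_crit : forall i : 'I_n, (i < k)%N ->
  q i ^+ e i *+ e i + (a * \prod_(l < n | (l < k)%N) q l ^+ b l) *+ b i = 0.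

Definition chart (i : 'I_n) : {mpoly K[n.-1]} :=
  if unlift i0 i is Some j then 'X_j + (q i)%:MP else 1.
Local Notation t := chart.
Let f := \sum_i t i ^+ e i + a *: \prod_(i < n | (i < k)%N) t i ^+ b i.

Lemma chart_lift j : t (lift i0 j) = 'X_j + (q (lift i0 j))%:MP.
Proof. by rewrite /t liftK. Qed.

Lemma mderiv_chart j i : (t i)^`M(j) = (i == lift i0 j)%:R.
Proof.
rewrite /t; case: unliftP => [l ->|->].
  by rewrite mderivD mderivC addr0 mderivXU (inj_eq lift_inj).
by rewrite -[1]/(1%:MP) mderivC (negPf (neq_lift _ _)).
Qed.

Lemma mcoeff0_chart i : (t i)@_0%MM = q i.
Proof.
rewrite /t; case: unliftP => [l _|->]; last by rewrite mcoeff1 eqxx.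
by rewrite mcoeffD mcoeffX mnm1_eq0 mcoeffC eqxx mulr1 add0r.
Qed.

Lemma fermat_e_gt0 i : (0 < e i)%N.
Proof.
have: (0 < d)%N.
  by rewrite -bw (bigD1 i0) //= addn_gt0 muln_gt0 b_gt0 ?w_gt0.
by rewrite -(ew i) muln_gt0 => /andP[].
Qed.

Let Q := a * \prod_(l < n | (l < k)%N) q l ^+ b l.

(** At [i0], where [q] is 1, the critical equation reads [e i0 + Q * b i0 = 0]. *)
Lemma fermat_Q_neq0 : Q != 0.
Proof.
apply/eqP=> Q0; have := q_crit i0k; rewrite -/Q Q0 mul0rn addr0 q_i0 expr1n.
by apply/eqP; rewrite pnatr_eq0 -lt0n fermat_e_gt0.
Qed.

(** If [q i] were 0, the critical equation would leave [Q * b i = 0]. *)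
Lemma fermat_head_neq0 (i : 'I_n) : (i < k)%N -> q i != 0.
Proof.
move=> ik; apply/eqP=> qi0; have := q_crit ik.
rewrite -/Q qi0 expr0n gtn_eqF ?fermat_e_gt0 // mul0rn add0r.
by apply/eqP; rewrite mulrn_eq0 negb_or -lt0n b_gt0 // fermat_Q_neq0.
Qed.

(** Head variables themselves lie in the Jacobian ideal; a tail variable enters it through its
    derivative, of exponent [e - 1]. *)
Let thr (l : 'I_n.-1) : nat :=
  if (lift i0 l < k)%N then 1 else (e (lift i0 l) - 1)%N.
Let box (u : 'X_{1..n.-1}) := forall l, (u l < thr l)%N.

Lemma fermat_deriv_tail j : (k <= lift i0 j)%N ->
  f^`M(j) = 'X_j ^+ thr j *+ e (lift i0 j).
Proof.
move=> kj; rewrite (mderiv_outside _ _ _ (mderiv_chart j)) -?leqNgt //.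
by rewrite chart_lift q_tail // addr0 /thr ltnNge kj subn1.
Qed.

Lemma is_ideal_outside_box :
  is_ideal (fun p : {mpoly K[n.-1]} => forall u, box u -> p@_u = 0).
Proof.
split=> [u _|p p' p0 p'0 u uB|p p' p'0 u uB]; first by rewrite mcoeff0.
  by rewrite mcoeffD p0 ?p'0 ?addr0.
rewrite mcoeffM big1 // => v /eqP uv; rewrite p'0 ?mulr0 // => l.
by apply: leq_ltn_trans (uB l); move/mnmP/(_ l): uv ->; rewrite mnmDE leq_addl.
Qed.

(** A tail derivative is a multiple of ['X_j ^+ thr j]. For a head derivative, each head coordinate
    is congruent to its constant value modulo the ideal [V], and the critical equation makes the
    result 0. *)
Lemma fermat_deriv_box j u : box u -> f^`M(j)@_u = 0.
Proof.
case: (ltnP (lift i0 j) k) => [jk|kj] u_box; last first.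
  rewrite fermat_deriv_tail // mcoeffMn mcoeffXn.
  case: eqP => [uE|]; last by rewrite mul0rn.
  by have := u_box j; rewrite -uE mulmnE mnm1E eqxx mul1n ltnn.
pose V (p : {mpoly K[n.-1]}) := forall u, box u -> p@_u = 0.
have V_ideal : is_ideal V := is_ideal_outside_box.
have tV (i : 'I_n) : (i < k)%N -> V (t i - (q i)%:MP).
  move=> ik; rewrite /t; case: unliftP => [l il|->]; last first.
    by rewrite q_i0 subrr => v _; rewrite mcoeff0.
  rewrite addrK => v /(_ l); rewrite /thr -il ik mcoeffX => vl.
  by case: eqP => // vE; rewrite -vE mnm1E eqxx in vl.
have [V0 VD VM] := V_ideal.
have VMn p c : V p -> V (p *+ c).
  by move=> Vp v vB; rewrite mcoeffMn Vp ?mul0rn.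
have Vadd x y x' y' : x' + y' = 0 -> V (x - x') -> V (y - y') -> V (x + y).
  by move=> xy0 /VD Vx /Vx; rewrite addrACA -opprD xy0 subr0.
have Vf : V (t (lift i0 j) * f^`M(j)).
  rewrite (mderiv_inside _ _ _ (mderiv_chart j)) //.
  set j' := lift i0 j; set T := \prod_(i | _) _.
  pose T' : {mpoly K[n.-1]} := \prod_(i < n | (i < k)%N) (q i)%:MP ^+ b i.
  have VT : V (T - T').
    by apply: (cong_prod V_ideal) => i ik; apply: (congX V_ideal); apply: tV.
  have Vt : V (t j' ^+ e j' - (q j')%:MP ^+ e j').
    by apply: (congX V_ideal); apply: tV.
  have crit : (q j')%:MP ^+ e j' *+ e j' + (a%:MP * T') *+ b j' = 0
      :> {mpoly K[n.-1]}.
    rewrite -(mpolyC0 n.-1) -(q_crit jk) mpolyCD !mpolyCMn mpolyCM.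
    rewrite rmorphXn rmorph_prod.
    by under [in RHS]eq_bigr do rewrite rmorphXn.
  apply: (Vadd _ _ _ _ crit); rewrite -?mul_mpolyC -mulrnBl; first exact: VMn.
  by rewrite -mulrBr; apply: VMn; apply: VM.
(* The factor [t (lift i0 j)] is replaced by the constant congruent to it, which is nonzero and can
   be divided out. *)
have : V (q (lift i0 j) *: f^`M(j)).
  rewrite -mul_mpolyC -[_ * _](subrK (t (lift i0 j) * f^`M(j))) -mulrBl.
  apply: VD => //; rewrite mulrC; apply: (VM); rewrite -opprB -mulN1r; apply: VM.
  exact: tV.
move/(_ u u_box)/eqP; rewrite mcoeffZ mulf_eq0 (negPf (fermat_head_neq0 jk)).
by move/eqP.
Qed.

Let J (p : {mpoly K[n.-1]}) := jacobian_ideal f (pseries_of p).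

Lemma is_ideal_jacobian : is_ideal J.
Proof.
split=> [|p p' Jp Jp'|p p' Jp'].
(* Zero is the empty sum; the index type ['I_0] makes the premise on the summands vacuous. *)
- apply: eq_jacobian_ideal
    (jacobian_ideal_sum [::] (g := fun _ : 'I_0 => pseries_of 0) _).
    by move=> u; rewrite big_nil /pseries_of mcoeff0.
  by case.
- apply: eq_jacobian_ideal (jacobian_idealD Jp Jp') => u.
  by rewrite /pseries_of mcoeffD.
- exact: eq_jacobian_ideal (pseries_mul_of p p')
    (jacobian_idealM (pseries_of_convergent p) Jp').
Qed.

Lemma jacobian_cancel_const (c : K) p : c != 0 -> J (c *: p) -> J p.
Proof.
move=> c_neq0; rewrite -mul_mpolyC; apply: jacobian_ideal_cancel.
by rewrite mcoeffC eqxx mulr1.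
Qed.

(** The cofactor [1 + p + ... + p ^ (c - 1)] has constant term [c], hence is a unit. *)
Lemma jacobian_root1 (p : {mpoly K[n.-1]}) c :
  p@_0%MM = 1 -> (0 < c)%N -> J (p ^+ c - 1) -> J (p - 1).
Proof.
move=> p0 c_gt0; rewrite subrX1 mulrC; apply: jacobian_ideal_cancel.
rewrite raddf_sum /= (eq_bigr (fun _ => 1)) => [|i _].
  by rewrite sumr_const card_ord pnatr_eq0 -lt0n.
by rewrite rmorphXn /= p0 expr1n.
Qed.

(* In the local algebra each s_i = x_i / q_i satisfies s_i ^ e_i = U, where
   U = prod_i s_i ^ b_i.  Raising U to the power d gives U ^ d = U ^ (d - c)
   with c = b_i0 w_i0 > 0, because s_i0 = 1; as U is a unit this forces U = 1,
   hence s_i = 1. *)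
Lemma fermat_head_in_jacobian l : (lift i0 l < k)%N -> J 'X_l.
Proof.
move=> lk; have J_ideal := is_ideal_jacobian; have [J0 JD JM] := J_ideal.
pose s i := (q i)^-1 *: t i.
have tE (i : 'I_n) : (i < k)%N -> t i = q i *: s i.
  by move=> ik; rewrite scalerA mulfV ?scale1r // fermat_head_neq0.
have s0 (i : 'I_n) : (i < k)%N -> (s i)@_0%MM = 1.
  by move=> ik; rewrite mcoeffZ mcoeff0_chart mulVf // fermat_head_neq0.
have s_i0 : s i0 = 1 by rewrite /s q_i0 invr1 scale1r /t unlift_none.
pose U := \prod_(i < n | (i < k)%N) s i ^+ b i.
have U0 : U@_0%MM = 1.
  by rewrite rmorph_prod big1 //= => i ik; rewrite rmorphXn /= s0 ?expr1n.
have sU (i : 'I_n) : (i < k)%N -> i != i0 -> J (s i ^+ e i - U).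
  move=> ik i_neq; have : exists j, i = lift i0 j.
    by case: (unliftP i0 i) i_neq => [j ->|->]; [exists j|rewrite eqxx].
  case=> j ij; have := JM (t i) _ (jacobian_ideal_deriv f j).
  rewrite {1}ij (mderiv_inside _ _ _ (mderiv_chart j)) -?ij //.
  have -> : \prod_(l < n | (l < k)%N) t l ^+ b l =
      (\prod_(l < n | (l < k)%N) q l ^+ b l) *: U.
    by rewrite -scaler_prod; apply: eq_bigr => l' l'k; rewrite {1}tE // exprZn.
  rewrite {1}tE // exprZn scalerA 2!scalerMnl.
  (* The critical equation makes the two coefficients opposite, so a nonzero multiple of
     [s i ^+ e i - U] remains. *)
  have -> : (a * \prod_(l < n | (l < k)%N) q l ^+ b l) *+ b i =
      - (q i ^+ e i *+ e i).
    by apply/eqP; rewrite -addr_eq0 addrC q_crit.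
  rewrite scaleNr -scalerBr; apply: jacobian_cancel_const.
  by rewrite mulrn_eq0 negb_or -lt0n fermat_e_gt0 expf_neq0 ?fermat_head_neq0.
pose c := (b i0 * w i0)%N.
have c_gt0 : (0 < c)%N by rewrite muln_gt0 b_gt0 ?w_gt0.
pose r := (\sum_(i < n | (i < k)%N && (i != i0)) b i * w i)%N.
have dE : d = (c + r)%N by rewrite -bw (bigD1 i0).
have JU1 : J (U - 1).
  apply: (@jacobian_root1 _ c) => //.
  (* Multiplied by the unit [U ^+ r], the element [U ^+ c - 1] becomes [U ^+ d - U ^+ r]. *)
  apply: (@jacobian_ideal_cancel _ _ _ (U ^+ r)).
    by rewrite rmorphXn /= U0 expr1n oner_neq0.
  rewrite mulrBr mulr1 -exprD addnC -dE.
  have -> : U ^+ r = \prod_(i < n | (i < k)%N && (i != i0)) U ^+ (b i * w i).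
    by rewrite prodrXr.
  (* Since [e i * w i = d], each factor on the right is [s i ^+ (b i * d)]; the factor at [i0] is
     1. *)
  have -> : U ^+ d =
      \prod_(i < n | (i < k)%N && (i != i0)) (s i ^+ e i) ^+ (b i * w i).
    rewrite /U (bigD1 i0) //= s_i0 expr1n mul1r -prodrXl.
    apply: eq_bigr => i _; rewrite -!exprM -(ew i).
    by congr (_ ^+ _); rewrite mulnCA.
  apply: (cong_prod is_ideal_jacobian) => i /andP[ik i_neq].
  by apply: (congX is_ideal_jacobian); apply: sU.
have : J (s (lift i0 l) - 1).
  apply: (@jacobian_root1 _ (e (lift i0 l))); rewrite ?s0 ?fermat_e_gt0 //.
  rewrite -[X in X - 1](subrK U) -addrA; apply: JD JU1.
  by apply: sU => //; rewrite eq_sym neq_lift.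
rewrite /s chart_lift scalerDr -[_ *: _%:MP]mul_mpolyC -mpolyCM.
rewrite mulVf ?fermat_head_neq0 // addrK; apply: jacobian_cancel_const.
by rewrite invr_neq0 ?fermat_head_neq0.
Qed.

Lemma fermat_germ_milnor :
  germ_milnor f (\prod_(i < n | (k <= i)%N) (e i - 1))%N.
Proof.
(* Head indices contribute the threshold 1, and the index [i0] missing from the chart is in the
   head. *)
have -> : (\prod_(i < n | (k <= i)%N) (e i - 1))%N = (\prod_l thr l)%N.
  rewrite big_mkcond (bigD1_ord i0) //= leqNgt i0k mul1n.
  by apply: eq_bigr => l _; rewrite /thr leqNgt; case: ltnP.
apply: germ_milnor_box => [l|j u]; last exact: fermat_deriv_box.
case: (ltnP (lift i0 l) k) => [lk|kl].
  by rewrite /thr lk expr1; apply: fermat_head_in_jacobian.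
have e_neq0 : (e (lift i0 l))%:R != 0 :> K by rewrite pnatr_eq0 -lt0n fermat_e_gt0.
apply: (jacobian_cancel_const e_neq0); rewrite scaler_nat -fermat_deriv_tail //.
exact: jacobian_ideal_deriv.
Qed.

End FermatGerm.

(** * From singular points of the weighted projective space to germs *)

Section SingularPoint.
Variables (R : realType) (n : nat) (w : 'I_n -> nat) (k : nat).
Local Notation K := R[i].
Hypotheses (w_gt0 : forall i, (0 < w i)%N) (w_dvd : forall i, (w i %| wdeg w)%N).
Variables (beta : expo w) (a : K).
Hypothesis beta_sum : (\sum_(i < n | (i < k)%N) beta i * w i)%N = wdeg w.
Hypothesis beta_neq0 : forall i : 'I_n, (i < k)%N -> beta i <> 0%N :> nat.
Local Notation F := (monomial_def k beta a).
Let e i := (wdeg w %/ w i)%N.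

Lemma critical_tail p (i : 'I_n) :
  (forall j, F^`M(j).@[p] = 0) -> (k <= i)%N -> p i = 0.
Proof.
move=> /(_ i) + ki.
rewrite (mderiv_outside _ _ _ (fun l => @mderivXU _ _ i l)) -?leqNgt //.
rewrite mevalMn rmorphXn /= mevalXU => /eqP.
rewrite mulrn_eq0 eqn0Ngt wdeg_div_gt0 //= expf_eq0.
by case/andP=> _ /eqP.
Qed.

Lemma critical_head p (i : 'I_n) :
  (forall j, F^`M(j).@[p] = 0) -> (i < k)%N ->
  p i ^+ e i *+ e i + (a * \prod_(l < n | (l < k)%N) p l ^+ beta l) *+ beta i = 0.
Proof.
move=> /(_ i) dF0 ik; have := congr1 (meval p)
  (@mderiv_inside _ _ _ _ _ _ e (fun l => beta l : nat) a
    (fun l => (l < k)%N) (fun l => @mderivXU _ _ i l) ik).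
rewrite rmorphM /= [(_)^`M(i).@[p]]dF0 mulr0 => /esym.
rewrite mevalD !mevalMn mevalZ rmorphXn rmorph_prod /= mevalXU.
by under eq_bigr do rewrite rmorphXn /= mevalXU.
Qed.

Lemma local_eq_chart i0 q : local_eq F i0 q =
  \sum_i chart i0 q i ^+ e i
    + a *: \prod_(i < n | (i < k)%N) chart i0 q i ^+ beta i.
Proof.
rewrite /local_eq comp_mpolyD comp_mpolyZ raddf_sum rmorph_prod /=.
by congr (_ + _ *: _); apply: eq_bigr => i _;
  rewrite rmorphXn /= comp_mpolyXU -tnth_nth tnth_mktuple.
Qed.

(** The critical representative [p] and the normalised one [q] lie in one orbit. The equations
    [x_i * dF/dx_i = 0] are weighted homogeneous of degree [wdeg w], so they pass from [p] to
    [q]. *)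
Lemma milnor_number_singular P : wsingular w F P ->
  milnor_number F P (\prod_(i < n | (k <= i)%N) (wdeg w %/ w i - 1))%N.
Proof.
case=> -[p0 [i1 p0_neq0] <-] [p [l l_neq0 pE] dFp] i0 q [l' l'_neq0 qE] q_i0.
pose c := l' / l.
have qp i : q i = c ^+ w i * p i.
  by rewrite pE qE mulrA -exprMn divfK.
have eE i : (e i * w i)%N = wdeg w by rewrite divnK.
have p_tail (i : 'I_n) : (k <= i)%N -> p i = 0 by apply: critical_tail.
(* Tail coordinates vanish at a critical point, so only head coordinates can be normalised to 1. *)
have i0k : (i0 < k)%N.
  rewrite ltnNge; apply/negP=> /p_tail p_i0.
  by move: q_i0; rewrite qp p_i0 mulr0 => /esym/eqP; rewrite oner_eq0.
rewrite local_eq_chart.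
apply: (@fermat_germ_milnor R n k (wdeg w) w) => // [i ik|i ki|i ik].
- by rewrite lt0n; apply/eqP/beta_neq0.
- by rewrite qp p_tail ?mulr0.
have -> : \prod_(l0 < n | (l0 < k)%N) q l0 ^+ beta l0 =
    c ^+ wdeg w * \prod_(l0 < n | (l0 < k)%N) p l0 ^+ beta l0.
  have -> : c ^+ wdeg w = \prod_(l0 < n | (l0 < k)%N) c ^+ (beta l0 * w l0).
    by rewrite prodrXr beta_sum.
  rewrite -big_split; apply: eq_bigr => i' _.
  by rewrite qp exprMn -exprM mulnC.
rewrite qp exprMn -exprM mulnC eE mulrCA -[X in X + _]mulrnAr.
rewrite -[X in _ + X]mulrnAr -mulrDr.
by rewrite (critical_head dFp ik) mulr0.
Qed.

End SingularPoint.

Theorem lemma14 (R : realType) (n : nat) (w : 'I_n -> nat)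
    (w_gt0 : forall i, (0 < w i)%N)
    (w_dvd : forall i, (w i %| wdeg w)%N)
    (k : nat) (k_gt0 : (1 <= k)%N) (k_le : (k <= n)%N)
    (w_gcd : \big[gcdn/0%N]_(i < n | (i < k)%N) w i = 1%N)
    (beta : expo w) (betaM : beta \in expoM w)
    (beta_len : wlen beta = 1%N)
    (beta_tail : forall i : 'I_n, (k <= i)%N -> beta i = 0%N :> nat) :
  #|clean_tails w k| = (\prod_(i < n | (k <= i)%N) (wdeg w %/ w i - 1))%N
  /\ ((forall i : 'I_n, (i < k)%N -> beta i <> 0%N :> nat) ->
      forall (a : R[i]) (P : set ('I_n -> R[i])),
        wsingular w (monomial_def k beta a) P ->
        milnor_number (monomial_def k beta a) P #|clean_tails w k|).
Proof.
have card_tails := card_clean_tails w_gt0 w_dvd w_gcd.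
split=> // beta_neq0 a P; rewrite card_tails.
apply: milnor_number_singular => //.
(* Membership in [expoM w] makes the division in [wlen] exact, so length 1 gives weighted degree
   [wdeg w]. *)
have wsumE : wsum beta = wdeg w.
  by move: betaM beta_len; rewrite inE /wlen => /divnK {2}<- ->; rewrite mul1n.
apply: etrans wsumE; rewrite /wsum [RHS](bigID (fun i : 'I_n => (i < k)%N)) /=.
by rewrite [X in (_ + X)%N]big1 ?addn0 // => i; rewrite -leqNgt => /beta_tail ->.
Qed.
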